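(* Let $\varepsilon,\delta\in(0,1)$ and let $P_{s2}=0$. In the two-power noisy Rayleigh measurement model described in the context, let $$\widehat{\sigma}_{\frac HV,N}^2=\frac{\overline{X_{1,N}^2}-\overline{X_{2,N}^2}}{P_{s1}\overline{X_{2,N}^2}-P_{s2}\overline{X_{1,N}^2}}.$$ If $$N>\frac{2(2+\varepsilon)(6+5\varepsilon)\ln\frac4\delta}{3\varepsilon^2},$$ then $$\lim_{P_{s1}\to\infty}\Pr\left\{\left|\frac{\widehat{\sigma}_{\frac HV,N}^2-\frac{\sigma_H^2}{\sigma_V^2}}{\frac{\sigma_H^2}{\sigma_V^2}}\right|<\varepsilon\right\}>1-\delta .$$
   Context: Two-power noisy Rayleigh measurement model: let $\sigma_H^2,\sigma_V^2>0$ (fixed) and $P_{s1}>P_{s2}\ge0$. For $\ell=1,2$ and $i=1,\dots,N$ ($N$ a positive integer), real (BPSK) symbols $S_{\ell,i}$ with $|S_{\ell,i}|^2=P_{s\ell}$ are transmitted, and one observes the complex random variables $X_{\ell,i}=H_{\ell,i}S_{\ell,i}+V_{\ell,i}$, where the real and imaginary parts of $H_{\ell,i}$ are Gaussian with mean $0$ and variance $\sigma_H^2$, the real and imaginary parts of $V_{\ell,i}$ are Gaussian with mean $0$ and variance $\sigma_V^2$, and all these real and imaginary parts (over all $\ell,i$) are mutually independent. Thus the $X_{\ell,i}$ are mutually independent, and the real and imaginary parts of $X_{\ell,i}$ are independent centered Gaussians of variance $P_{s\ell}\sigma_H^2+\sigma_V^2$. Define $$\overline{X_{\ell,N}^2}=\frac{1}{2N}\sum_{i=1}^{N}|X_{\ell,i}|^2,\qquad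 \ell=1,2.$$ *)

(* Defs.v *)
From HB Require Import structures.
From mathcomp Require Import all_boot all_order all_algebra.
From mathcomp Require Export all_classical all_reals all_analysis.
From mathcomp Require Export complex.

Set Implicit Arguments.
Unset Strict Implicit.
Unset Printing Implicit Defensive.

Import Order.TTheory GRing.Theory Num.Theory.
Import numFieldNormedType.Exports.

Local Open Scope classical_set_scope.
Local Open Scope ring_scope.

Definition mutually_independent (d : measure_display) (T : measurableType d)
    (R : realType) (P : probability T R) (I : finType) (Y : I -> {RV P >-> R}) :=
  forall (J : {set I}) (B : I -> set R), (forall i, measurable (B i)) ->
    P (\bigcap_(i in [set` J]) (Y i @^-1` B i))
    = (\prod_(i in J) P (Y i @^-1` B i))%E.

(* [normal_prob] takes a standard deviation, hence the square root of the
   variance [v].  Laws are compared on Borel sets only. *)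
Definition centered_gaussian (d : measure_display) (T : measurableType d)
    (R : realType) (P : probability T R) (v : R) (Y : {RV P >-> R}) :=
  forall B : set R, measurable B ->
    distribution P Y B = normal_prob 0 (Num.sqrt v) B.

(* A family [l : 'I_2] is indexed with [ord0] for the first power level and
   [ord_max] for the second one. *)
Record two_power_data (R : realType) (N : nat) := TwoPowerData {
  disp : measure_display ;
  Omega : measurableType disp ;
  Pr : probability Omega R ;
  symbol : 'I_2 -> 'I_N -> R ;
  HRe : 'I_2 -> 'I_N -> {RV Pr >-> R} ;
  HIm : 'I_2 -> 'I_N -> {RV Pr >-> R} ;
  VRe : 'I_2 -> 'I_N -> {RV Pr >-> R} ;
  VIm : 'I_2 -> 'I_N -> {RV Pr >-> R} }.

Section Model.
Variables (R : realType) (N : nat) (M : two_power_data R N).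

Definition fading (l : 'I_2) (i : 'I_N) (w : Omega M) : R[i] :=
  Complex (HRe M l i w) (HIm M l i w).

Definition noise (l : 'I_2) (i : 'I_N) (w : Omega M) : R[i] :=
  Complex (VRe M l i w) (VIm M l i w).

Definition observation (l : 'I_2) (i : 'I_N) (w : Omega M) : R[i] :=
  fading l i w * (symbol M l i)%:C%C + noise l i w.

(* The first boolean selects fading ([true]) or noise, the second one the real
   ([true]) or imaginary part. *)
Definition gaussian_part (k : bool * bool * 'I_2 * 'I_N) : {RV Pr M >-> R} :=
  let: (isH, isRe, l, i) := k in
  if isH then (if isRe then HRe M l i else HIm M l i)
  else (if isRe then VRe M l i else VIm M l i).

(* [sH2] and [sV2] stand for the variances sigma_H^2 and sigma_V^2. *)
Definition two_power_rayleigh (sH2 sV2 Ps1 Ps2 : R) : Prop :=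
  [/\ 0 <= Ps2 < Ps1,
      forall i, `|symbol M ord0 i| ^+ 2 = Ps1
        /\ `|symbol M ord_max i| ^+ 2 = Ps2,
      forall l i, centered_gaussian sH2 (HRe M l i)
        /\ centered_gaussian sH2 (HIm M l i),
      forall l i, centered_gaussian sV2 (VRe M l i)
        /\ centered_gaussian sV2 (VIm M l i)
    & mutually_independent gaussian_part].

Definition mean_power (l : 'I_2) (w : Omega M) : R :=
  (2 * N%:R)^-1 * \sum_(i < N) Normc.normc (observation l i w) ^+ 2.

(* The quotient takes the value 0 where the denominator vanishes. *)
Definition ratio_estimator (Ps1 Ps2 : R) (w : Omega M) : R :=
  (mean_power ord0 w - mean_power ord_max w)
  / (Ps1 * mean_power ord_max w - Ps2 * mean_power ord0 w).

End Model.

(* Main.v *)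
(* All gaussian parts at power [Ps1] have the same joint law as at power 1, so
   the probability can be computed on the space at power 1, with only the symbols
   depending on [Ps1].  There the relative error converges pointwise to that of
   the ratio A / B, where A is the fading power and B the noise power of
   the silent observations, and the boundary event |error| = eps is null because
   it forces the square of one gaussian part to be a function of the others.
   For the lower bound, Chernoff with the moment generating function of a
   squared gaussian gives, for Q = (A / sH2) / (B / sV2),
     P (Q >= q) <= (4 q / (1 + q)^2)^N  when q > 1,
     P (Q <= q) <= (4 q / (1 + q)^2)^N  when q < 1,
   and 4 q / (1 + q)^2 = 1 - ((q - 1) / (q + 1))^2 is at most
   exp (- (eps / (2 + eps))^2) at q = 1 + eps and q = 1 - eps. *)
From HB Require Import structures.
Require Import Defs.
From mathcomp Require Import all_boot all_order all_algebra.
From mathcomp Require Import all_classical all_reals all_analysis.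
From mathcomp Require Import measurable_realfun ring lra.

Import Order.TTheory GRing.Theory Num.Theory.
Import numFieldNormedType.Exports.

Local Open Scope classical_set_scope.
Local Open Scope ring_scope.

(** * Laws of finite families on real tuples *)

(** Rectangles are stable under intersection and generate the sigma-algebra of tuples, so a finite
    measure is determined by its values on them. *)
Lemma tuple_measure_unique (R : realType) (n : nat)
    (m1 m2 : {measure set (n.-tuple (R)) -> \bar R}) :
  (forall B : 'I_n -> set R, (forall i, measurable (B i)) ->
    m1 [set t | forall i, B i (tnth t i)]
    = m2 [set t | forall i, B i (tnth t i)]) ->
  (m1 setT < +oo)%E ->
  forall E, measurable E -> m1 E = m2 E.
Proof.
move=> m12 m1T.
pose G := [set E : set (n.-tuple (R)) |
  exists2 B : 'I_n -> set R, (forall i, measurable (B i)) &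
    E = [set t | forall i, B i (tnth t i)]].
have GT : G setT.
  by exists (fun=> setT) => //; apply/seteqP; split.
apply: (@measure_unique _ _ _ G (fun=> setT)) => //.
- apply/seteqP; split.
    apply: smallest_sub; first exact: smallest_sigma_algebra.
    rewrite -bigcup_seq => E [i _ [B mB <-]].
    apply: sub_sigma_algebra.
    exists (fun j => if j == i then B else setT); first by move=> j; case: ifP.
    apply/seteqP; split => t /=; first by move=> [_ Bt] j; case: eqP => // ->.
    by move=> /(_ i); rewrite eqxx.
  apply: smallest_sub; first exact: sigma_algebra_measurable.
  move=> E [B mB ->].
  rewrite (_ : [set t | _] = \bigcap_(i in [set: 'I_n])
    ((fun t => tnth t i) @^-1` B i)); last first.
    by apply/seteqP; split => t /= h i; [move=> _|]; exact: h.
  apply: fin_bigcap_measurable => // i _.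
  by rewrite -[X in measurable X]setTI; exact: (measurable_tnth i measurableT (mB i)).
- move=> _ _ [B mB ->] [C mC ->]; exists (fun i => B i `&` C i).
    by move=> i; exact: measurableI.
  by apply/seteqP; split => t /= => [[b c] i|h]; split => // i; case: (h i).
- by rewrite bigcup_const//; exists 0%N.
- by move=> _ [B mB ->]; exact: m12.
Qed.

Section tupled.
Context {d} {T : measurableType d} {R : realType} {I : finType}.

Definition tupled (Y : I -> {mfun T >-> R}) (w : T) : #|I|.-tuple R :=
  [tuple Y (enum_val i) w | i < #|I|].

Lemma tnth_tupled (Y : I -> {mfun T >-> R}) w k :
  tnth (tupled Y w) (enum_rank k) = Y k w.
Proof. by rewrite tnth_mktuple enum_rankK. Qed.

Lemma measurable_tupled (Y : I -> {mfun T >-> R}) :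
  measurable_fun setT (tupled Y).
Proof.
apply/measurable_fun_tnthP => i; rewrite (_ : _ \o _ = Y (enum_val i)) //.
by apply/funext => w /=; rewrite tnth_mktuple.
Qed.

HB.instance Definition _ (Y : I -> {mfun T >-> R}) :=
  isMeasurableFun.Build _ _ _ _ (tupled Y) (measurable_tupled Y).

Lemma tupled_rectangle (Y : I -> {mfun T >-> R}) (B : 'I_#|I| -> set R) :
  tupled Y @^-1` [set t | forall i, B i (tnth t i)]
  = \bigcap_(k in [set` [set: I]%SET]) (Y k @^-1` B (enum_rank k)).
Proof.
apply/seteqP; split => w /= h.
  by move=> k _ /=; rewrite -(tnth_tupled Y); exact: h.
move=> i; have := h (enum_val i); rewrite /= inE => /(_ isT).
by rewrite tnth_mktuple enum_valK.
Qed.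

End tupled.

(** On a rectangle both laws are the product of the same marginals. This carries an event from one
    probability space to another. *)
Lemma independent_law_unique {d d'} {T : measurableType d}
    {T' : measurableType d'} {R : realType} {I : finType}
    {P : probability T R} {P' : probability T' R}
    (Y : I -> {RV P >-> R}) (Y' : I -> {RV P' >-> R}) :
  mutually_independent Y -> mutually_independent Y' ->
  (forall k B, measurable B -> P (Y k @^-1` B) = P' (Y' k @^-1` B)) ->
  forall E, measurable E -> P (tupled Y @^-1` E) = P' (tupled Y' @^-1` E).
Proof.
move=> iY iY' YY'; apply: (@tuple_measure_unique _ _ (distribution P (tupled Y))
  (distribution P' (tupled Y'))); last first.
  exact: (le_lt_trans (probability_le1 _ measurableT) (ltry 1)).
move=> B mB.
transitivity (\prod_(k in [set: I]%SET) P (Y k @^-1` B (enum_rank k)))%E.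
  by rewrite -iY//; congr (P _); exact: tupled_rectangle.
transitivity (\prod_(k in [set: I]%SET) P' (Y' k @^-1` B (enum_rank k)))%E.
  by apply: eq_bigr => k _; exact: YY'.
by rewrite -iY'//; congr (P' _); apply/esym; exact: tupled_rectangle.
Qed.

(** * Separating one coordinate of an independent family *)

Section zeroed.
Context {d} {T : measurableType d} {R : realType} {I : finType}
  {P : probability T R}.
Variable Y : I -> {RV P >-> R}.

(* Blanking coordinate [j], instead of deleting it, keeps the index type [I]. *)
Definition zeroed (j k : I) : {RV P >-> R} :=
  if k == j then (cst 0 : {mfun T >-> R}) else Y k.

(** For fixed [A], both sides are finite measures in [E], so it suffices to compare them on
    rectangles, where mutual independence applies. *)
Lemma independent_zeroed : mutually_independent Y ->
  forall (j : I) A E, measurable A -> measurable E ->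
  P (Y j @^-1` A `&` tupled (zeroed j) @^-1` E)
  = (P (Y j @^-1` A) * P (tupled (zeroed j) @^-1` E))%E.
Proof.
move=> iY j A E mA mE.
have mYA : measurable (Y j @^-1` A).
  by rewrite -[X in measurable X]setTI; exact: measurable_funP.
have PA0 : 0 <= fine (P (Y j @^-1` A)) by exact: fine_ge0.
pose m1 := pushforward (mrestr P mYA) (tupled (zeroed j)).
pose m2 := mscale (NngNum PA0) (distribution P (tupled (zeroed j))).
have -> : P (Y j @^-1` A `&` tupled (zeroed j) @^-1` E) = m1 E.
  by rewrite /m1 /pushforward /mrestr /= setIC.
have -> : (P (Y j @^-1` A) * P (tupled (zeroed j) @^-1` E))%E = m2 E.
  by rewrite /m2 /mscale /= fineK ?fin_num_measure.
apply: tuple_measure_unique => //=; last first.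
  rewrite /pushforward /mrestr /=; apply: le_lt_trans (ltry 1); apply: probability_le1.
  by apply: measurableI => //; rewrite preimage_setT.
move=> B mB.
pose Z := \bigcap_(k in [set` [set: I]%SET]) (zeroed j k @^-1` B (enum_rank k)).
have ZE : tupled (zeroed j) @^-1` [set t | forall i, B i (tnth t i)] = Z.
  exact: tupled_rectangle.
transitivity (P (Z `&` Y j @^-1` A)); first by congr (P (_ `&` _)).
transitivity (P (Y j @^-1` A) * P Z)%E; last first.
  rewrite /m2 /mscale /= fineK ?fin_num_measure //.
  by congr (_ * P _)%E; apply/esym.
rewrite {ZE}/Z.
(* The blanked coordinate is constantly 0: its side of the rectangle either contains 0 and imposes
   nothing, or makes the event empty. *)
have [B0|B0] := pselect (B (enum_rank j) 0); last first.
  rewrite (_ : \bigcap_(_ in _) _ = set0) ?set0I ?measure0 ?mule0 //.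
  apply/seteqP; split => // w /(_ j); rewrite /= inE => /(_ isT).
  by rewrite /zeroed eqxx.
have rest : \bigcap_(k in [set` [set: I]%SET]) (zeroed j k @^-1` B (enum_rank k)) =
    \bigcap_(k in [set` (~: [set j])%SET]) (Y k @^-1` B (enum_rank k)).
  apply/seteqP; split => w /= h k; rewrite /= !inE /zeroed => kj.
    by have := h k; rewrite /= inE /zeroed (negbTE kj); apply.
  by case: eqP => [->//|/eqP kj' /=]; apply: h; rewrite /= !inE.
rewrite rest iY; last by move=> k; exact: mB.
(* The slot freed by blanking takes [A], so the intersection is again a rectangle event of [Y]. *)
pose B' k := if k == j then A else B (enum_rank k).
transitivity (P (\bigcap_(k in [set` [set: I]%SET]) (Y k @^-1` B' k))).
  congr (P _); apply/seteqP; split => w /=.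
    move=> [h hA] k _ /=; rewrite /B'; case: eqP => [->//|/eqP kj].
    by apply: h; rewrite /= !inE.
  move=> h; split; last by have := h j; rewrite /= inE /B' eqxx; apply.
  move=> k; rewrite /= !inE => kj; have := h k.
  by rewrite /= inE /B' (negbTE kj); apply.
rewrite iY; last by move=> k; rewrite /B'; case: ifP.
rewrite (bigD1 j) ?inE //=; congr (_ * _)%E; first by rewrite /B' eqxx.
apply: eq_big => k; first by rewrite !inE.
by rewrite /B' !inE /= => /negbTE ->.
Qed.

End zeroed.

(** * Integrals and null sets for independent pairs *)

Section independent_pair.
Context {d d1 d2} {T : measurableType d} {T1 : measurableType d1}
  {T2 : measurableType d2} {R : realType} {P : probability T R}.
Variables (X : {mfun T >-> T1}) (Z : {mfun T >-> T2}).

Definition pairing (w : T) : T1 * T2 := (X w, Z w).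

Lemma measurable_pairing : measurable_fun setT pairing.
Proof. exact: measurable_fun_pair. Qed.

HB.instance Definition _ :=
  isMeasurableFun.Build _ _ _ _ pairing measurable_pairing.

Hypothesis XZ : forall A E, measurable A -> measurable E ->
  P (X @^-1` A `&` Z @^-1` E) = (P (X @^-1` A) * P (Z @^-1` E))%E.

Lemma distribution_pairing S : measurable S ->
  distribution P pairing S = (distribution P X \x distribution P Z)%E S.
Proof.
move=> mS; apply/esym.
apply: (@product_measure_unique _ _ _ _ _ (distribution P X) (distribution P Z)
  (distribution P pairing)) => // A B mA mB.
Qed.

(** The pair has the product law, and Tonelli splits the integral; both sides may be infinite. *)
Lemma ge0_integral_independentM (f : T1 -> R) (g : T2 -> R) :
  measurable_fun setT f -> measurable_fun setT g ->
  (forall x, 0 <= f x) -> (forall z, 0 <= g z) ->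
  (\int[P]_w (f (X w) * g (Z w))%:E
   = \int[P]_w (f (X w))%:E * \int[P]_w (g (Z w))%:E)%E.
Proof.
move=> mf mg f0 g0.
pose TT : measurableType _ := (T1 * T2)%type.
pose h (p : TT) : \bar R := ((f p.1 * g p.2)%:E)%E.
have mh : measurable_fun [set: TT] h.
  apply/measurable_EFinP; apply: measurable_funM.
    exact: (measurableT_comp mf).
  exact: (measurableT_comp mg).
have h0 p : (0 <= h p)%E by rewrite lee_fin mulr_ge0.
have meF : measurable_fun setT (EFin \o f) by exact/measurable_EFinP.
have meG : measurable_fun setT (EFin \o g) by exact/measurable_EFinP.
transitivity (\int[distribution P pairing]_p h p)%E.
  by rewrite ge0_integral_distribution.
transitivity (\int[(distribution P X \x distribution P Z)%E]_p h p)%E.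
  by apply: eq_measure_integral => S mS _; exact: distribution_pairing.
rewrite fubini_tonelli1 //.
transitivity (\int[distribution P X]_x ((f x)%:E * \int[distribution P Z]_z (g z)%:E))%E.
  apply: eq_integral => x _; rewrite /fubini_F -ge0_integralZl //.
  - by move=> z _; rewrite lee_fin.
  - by rewrite lee_fin.
rewrite ge0_integralZr //=; last 2 first.
- by move=> x _; rewrite lee_fin.
- by apply: integral_ge0 => z _; rewrite lee_fin.
by congr (_ * _)%E; rewrite ge0_integral_distribution // => ?; rewrite lee_fin.
Qed.

(** Under the product law, the measure of [S] is the integral of the measures of its sections. *)
Lemma null_sections S : measurable S ->
  (forall x, P (Z @^-1` xsection S x) = 0%E) -> P (pairing @^-1` S) = 0%E.
Proof.
move=> mS S0; have := distribution_pairing _ mS.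
rewrite {1}/distribution /= /pushforward => ->.
rewrite /product_measure1; apply: integral0_eq => x _.
exact: S0.
Qed.

End independent_pair.

(** * Normal law: null sets and exponential moments *)

Section normal.
Context {R : realType}.

(** The equation has at most two roots, and the normal law is dominated by Lebesgue measure. *)
Lemma normal_prob_sqr_eq0 (s c y : R) : c != 0 ->
  normal_prob 0 s [set x | c * x ^+ 2 = y] = 0%E.
Proof.
move=> c0; apply/eqP; rewrite eq_le measure_ge0 andbT.
have mS : measurable [set Num.sqrt (y / c); - Num.sqrt (y / c)].
  exact: measurableU.
have S0 : normal_prob 0 s [set Num.sqrt (y / c); - Num.sqrt (y / c)] = 0%E.
  apply: (null_content_dominatesP _ _).1 (normal_prob_dominates 0 s) _ mS _.
  by apply: countable_lebesgue_measure0; apply: finite_set_countable.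
rewrite -S0; apply: le_measure; rewrite ?inE //.
  rewrite (_ : [set x | _] = (fun x => c * x ^+ 2) @^-1` [set y])//.
  rewrite -[X in measurable X]setTI.
  have: measurable_fun setT (fun x : R => c * x ^+ 2) by apply: measurable_funM.
  by apply.
move=> x /= cxy; have -> : y / c = x ^+ 2 by rewrite -cxy mulrAC divff // mul1r.
rewrite sqrtr_sqr; have [x0|x0] := leP 0 x.
  by left; rewrite ger0_norm.
by right; rewrite ltr0_norm // opprK.
Qed.

(** The density and the Radon-Nikodym derivative have the same integral over every measurable set,
    hence agree almost everywhere. *)
Lemma ge0_integral_normal_prob (m s : R) (f : R -> \bar R) : s != 0 ->
  (forall x, 0 <= f x)%E -> measurable_fun setT f ->
  (\int[normal_prob m s]_x f x
   = \int[lebesgue_measure]_x (f x * (normal_pdf m s x)%:E))%E.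
Proof.
move=> s0 f0 mf.
have dom := normal_prob_dominates m s.
rewrite -(Radon_Nikodym_SigmaFinite.change_of_variables dom) //.
apply: ae_eq_integral => //.
- apply: emeasurable_funM => //.
  exact: measurable_int (Radon_Nikodym_SigmaFinite.f_integrable dom).
- apply: emeasurable_funM => //; apply/measurable_EFinP.
  exact: measurable_normal_pdf.
- apply: ae_eqe_mul2l; apply: integral_ae_eq => //.
  + exact: Radon_Nikodym_SigmaFinite.f_integrable.
  + by apply/measurable_EFinP; exact: measurable_normal_pdf.
  + by move=> A _ mA; rewrite -Radon_Nikodym_SigmaFinite.f_integral.
Qed.

(** With [q = 1 - 2 * c * s ^+ 2], multiplying the density by [expR (c * x ^+ 2)] gives
    [(Num.sqrt q)^-1] times the centered normal density of standard deviation [s / Num.sqrt q]. *)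
Lemma integral_expR_sqr_normal (s c : R) : 0 < s -> 2 * c * s ^+ 2 < 1 ->
  (\int[normal_prob 0 s]_x (expR (c * x ^+ 2))%:E
   = (Num.sqrt (1 - 2 * c * s ^+ 2))^-1%:E)%E.
Proof.
move=> s0 cs.
set q := 1 - 2 * c * s ^+ 2.
have q0 : 0 < q by rewrite subr_gt0.
pose s' := s / Num.sqrt q.
have sq0 : 0 < Num.sqrt q by rewrite sqrtr_gt0.
have s'0 : 0 < s' by rewrite divr_gt0.
have mf : measurable_fun setT (fun x : R => (expR (c * x ^+ 2))%:E).
  by apply/measurable_EFinP; apply: measurableT_comp => //; exact: measurable_funM.
have f0 x : (0 <= (expR (c * x ^+ 2))%:E)%E by rewrite lee_fin expR_ge0.
rewrite (ge0_integral_normal_prob _ _ _ _ f0 mf) ?gt_eqF //.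
transitivity (\int[lebesgue_measure]_x ((Num.sqrt q)^-1%:E * (normal_pdf 0 s' x)%:E))%E.
  apply: eq_integral => x _; rewrite -!EFinM; congr EFin.
  rewrite !normal_pdfE ?gt_eqF // /normal_fun /normal_peak !subr0.
  have -> : Num.sqrt (s' ^+ 2 * pi *+ 2) = Num.sqrt (s ^+ 2 * pi *+ 2) / Num.sqrt q.
    rewrite /s' exprMn exprVn sqr_sqrtr ?(ltW q0)// -sqrtrV ?(ltW q0)//.
    rewrite -sqrtrM; last by rewrite mulrn_wge0 // mulr_ge0 ?sqr_ge0 ?pi_ge0.
    by congr Num.sqrt; ring.
  rewrite invf_div -[X in _ = _ * X]mulrA mulKf ?gt_eqF //.
  rewrite mulrCA; congr (_ * _); rewrite -expRD; congr expR.
  rewrite /s' exprMn exprVn sqr_sqrtr ?(ltW q0)// /q.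
  have s2 : s ^+ 2 != 0 by rewrite sqrf_eq0 gt_eqF.
  have q2 : 1 - 2 * c * s ^+ 2 != 0 by rewrite gt_eqF.
  by field; rewrite q2 gt_eqF.
have mp : measurable_fun setT (fun x => (normal_pdf 0 s' x)%:E).
  by apply/measurable_EFinP; exact: measurable_normal_pdf.
have p0 x : setT x -> (0 <= (normal_pdf 0 s' x)%:E)%E.
  by move=> _; rewrite lee_fin normal_pdf_ge0.
have r0 : (0 <= (Num.sqrt q)^-1%:E)%E by rewrite lee_fin invr_ge0 ltW.
rewrite ge0_integralZl //.
by rewrite integral_normal_pdf mule1.
Qed.

End normal.

(** * Centered gaussians and sums of their squares *)

Section borel_copy.
Context {d} {T : measurableType d} {R : realType}.

(* The library measures [R] by two convertible structures with distinct
   displays; [normal_prob] lives on the second one, [measurableTypeR R]. *)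
Definition borel_copy (X : {mfun T >-> R}) : T -> measurableTypeR R := X.

Lemma measurable_borel_copy (X : {mfun T >-> R}) :
  measurable_fun setT (borel_copy X).
Proof. by move=> mT B mB; exact: (measurable_funPT X mT B mB). Qed.

HB.instance Definition _ (X : {mfun T >-> R}) :=
  isMeasurableFun.Build _ _ _ _ (borel_copy X) (measurable_borel_copy X).

Lemma ge0_integral_centered_gaussian {P : probability T R} (v : R)
    (X : {RV P >-> R}) (f : R -> R) :
  centered_gaussian v X -> measurable_fun setT f -> (forall x, 0 <= f x) ->
  (\int[P]_w (f (X w))%:E = \int[normal_prob 0 (Num.sqrt v)]_x (f x)%:E)%E.
Proof.
move=> gX mf f0.
have mf' : measurable_fun (setT : set (measurableTypeR R)) (fun x => (f x)%:E).
  have /measurable_EFinP mef := mf.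
  by move=> mT B mB; exact: mef.
transitivity (\int[distribution P (borel_copy X)]_x (f x)%:E)%E.
  rewrite ge0_integral_distribution //.
apply: eq_measure_integral => A mA _; exact: gX.
Qed.

End borel_copy.

Section independent_gaussian.
Context {d} {T : measurableType d} {R : realType} {I : finType}
  {P : probability T R}.
Variables (Y : I -> {RV P >-> R}) (v : I -> R).
Hypothesis iY : mutually_independent Y.
Hypothesis v0 : forall k, 0 < v k.
Hypothesis gY : forall k, centered_gaussian (v k) (Y k).

(** Induction on [r]: the head variable is independent of the tuple with its coordinate blanked, and
    [uniq r] keeps that coordinate out of the remaining sum. *)
Lemma integral_expR_sum_sqr (c : I -> R) (r : seq I) :
  (forall k, 2 * c k * v k < 1) -> uniq r ->
  (\int[P]_w (expR (\sum_(k <- r) c k * Y k w ^+ 2))%:E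
   = (\prod_(k <- r) (Num.sqrt (1 - 2 * c k * v k))^-1)%:E)%E.
Proof.
move=> cv; elim: r => [_|j r IH /= /andP[jr ur]].
  under eq_integral do rewrite big_nil expR0.
  rewrite big_nil integral_cst //. rewrite mul1e; exact: probability_setT.
pose f (x : R) := expR (c j * x ^+ 2).
pose g (t : #|I|.-tuple R) := expR (\sum_(k <- r) c k * tnth t (enum_rank k) ^+ 2).
have mf : measurable_fun setT f.
  by apply: measurableT_comp => //; exact: measurable_funM.
have mg : measurable_fun setT g.
  apply: measurableT_comp => //; apply: measurable_sum => k.
  by apply: measurable_funM => //; apply: measurable_funX; exact: measurable_tnth.
have gE w : g (tupled (zeroed Y j) w) = expR (\sum_(k <- r) c k * Y k w ^+ 2).
  congr expR; apply: eq_big_seq => k kr; rewrite tnth_tupled /zeroed.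
  by case: eqP => [kj|//]; rewrite -kj kr in jr.
transitivity (\int[P]_w (f (Y j w) * g (tupled (zeroed Y j) w))%:E)%E.
  by apply: eq_integral => w _; rewrite big_cons expRD gE.
rewrite ge0_integral_independentM //; last 3 first.
- exact: independent_zeroed.
- by move=> x; exact: expR_ge0.
- by move=> x; exact: expR_ge0.
under [X in (_ * X)%E]eq_integral do rewrite gE.
rewrite IH // big_cons EFinM; congr (_ * _)%E.
rewrite (ge0_integral_centered_gaussian _ _ _ (gY j) mf) ?expR_ge0 //; last first.
  by move=> x; exact: expR_ge0.
by rewrite integral_expR_sqr_normal ?sqrtr_gt0 // sqr_sqrtr // ltW.
Qed.

(** Once the other coordinates are fixed, [c * Y j ^+ 2] must hit one given value, which has
    probability 0 under a normal law; so all sections are null. *)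
Lemma gaussian_sqr_null (j : I) (c : R) (g : #|I|.-tuple R -> R) :
  c != 0 -> measurable_fun setT g ->
  P [set w | c * Y j w ^+ 2 = g (tupled (zeroed Y j) w)] = 0%E.
Proof.
move=> c0 mg.
pose S := [set p : #|I|.-tuple R * R | c * p.2 ^+ 2 = g p.1].
have mS : measurable S.
  rewrite (_ : S = (fun p : #|I|.-tuple R * R => c * p.2 ^+ 2 - g p.1) @^-1` [set 0]); last first.
    apply/seteqP; split => p /=; first by move=> ->; rewrite subrr.
    by move/eqP; rewrite subr_eq0 => /eqP.
  rewrite -[X in measurable X]setTI.
  suff: measurable_fun setT (fun p : #|I|.-tuple R * R => c * p.2 ^+ 2 - g p.1).
    by apply.
  apply: measurable_funB; last exact: measurableT_comp.
  by apply: measurable_funM => //; exact: measurable_funX.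
have := @null_sections _ _ _ _ _ _ _ P (tupled (zeroed Y j)) (Y j) _ S mS; apply.
- by move=> A E mA mE; rewrite setIC independent_zeroed // muleC.
- move=> t; have := normal_prob_sqr_eq0 (Num.sqrt (v j)) c (g t) c0.
  rewrite -gY; last first.
    have := measurable_xsection t mS.
    by rewrite /xsection; congr measurable; apply/seteqP; split => x /=; rewrite inE.
  rewrite /distribution /pushforward => <-; congr (P _).
  by apply/seteqP; split => w /=; rewrite /xsection /= inE.
Qed.

End independent_gaussian.

(** * Limits and exponential bounds of probabilities *)

(** Off the null event where the norm of [X] equals [e], the indicators are eventually constant at
    each point, so dominated convergence applies with the bound 1. *)
Lemma cvg_probability_norm_lt {d} {T : measurableType d} {R : realType}
    (P : probability T R) (X_ : nat -> T -> R) (X : T -> R) (e : R) :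
  (forall n, measurable_fun setT (X_ n)) -> measurable_fun setT X ->
  (forall w, X_ n w @[n --> \oo] --> X w) ->
  P [set w | `|X w| = e] = 0%E ->
  fine (P [set w | `|X_ n w| < e]) @[n --> \oo]
    --> fine (P [set w | `|X w| < e]).
Proof.
move=> mX_ mX cvgX X0.
have mlt (Z : T -> R) : measurable_fun setT Z -> measurable [set w | `|Z w| < e].
  move=> mZ; rewrite -[X in measurable X]setTI.
  have mnZ : measurable_fun setT (Num.norm \o Z) by exact: measurableT_comp.
  by have := mnZ measurableT _ (measurable_itv `]-oo, e[); congr measurable;
    apply/seteqP; split => w /=; rewrite in_itv.
have mN : measurable [set w | `|X w| = e].
  have mnX : measurable_fun setT (Num.norm \o X) by exact: measurableT_comp.
  by have := mnX measurableT _ (measurable_set1 e); rewrite setTI.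
pose f_ n w : \bar R := (\1_[set w | `|X_ n w| < e] w)%:E.
pose f w : \bar R := (\1_[set w | `|X w| < e] w)%:E.
have mf_ n : measurable_fun setT (f_ n).
  by apply/measurable_EFinP; apply: measurable_indic; exact: mlt.
have mf : measurable_fun setT f.
  by apply/measurable_EFinP; apply: measurable_indic; exact: mlt.
have Ptoo : (P setT < +oo)%E by exact: (le_lt_trans (probability_le1 _ measurableT) (ltry 1)).
have ig : P.-integrable setT (cst 1%E).
  by apply: finite_measure_integrable_cst.
have f_f : {ae P, forall w, setT w -> f_ ^~ w @ \oo --> f w}.
  exists [set w | `|X w| = e]; split => // w /=; apply: contra_notP => /eqP Xe _.
  have cn : `|X_ n w| @[n --> \oo] --> `|X w| by apply: cvg_norm; exact: cvgX.
  rewrite /f_ /f.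
  apply: cvg_near_cst.
  move: Xe; rewrite neq_lt => /orP[Xe|Xe].
    near=> n; have Xn : `|X_ n w| < e by near: n; exact: (cvgr_lt _ cn).
    by rewrite !indicE !mem_set.
  near=> n; have Xn : e < `|X_ n w| by near: n; exact: (cvgr_gt _ cn).
  by rewrite !indicE !memNset //=; apply/negP; rewrite -leNgt ltW.
have f_g : {ae P, forall w n, setT w -> (`|f_ n w| <= cst 1 w)%E}.
  apply: aeW => w n _; rewrite /f_ indicE abse_EFin lee_fin.
  by case: (_ \in _); rewrite ?normr1 ?normr0.
have [_ _ h] := dominated_convergence measurableT mf_ mf f_f ig f_g.
have fE (Z : T -> R) (mZ : measurable_fun setT Z) :
    (\int[P]_w (\1_[set w | (`|Z w| < e)%R] w)%:E = P [set w | (`|Z w| < e)%R])%E.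
  by rewrite integral_indic ?setIT //; exact: mlt.
apply: fine_cvg; rewrite fineK ?fin_num_measure //; last exact: mlt.
rewrite -fE //; apply: cvg_trans h; apply: near_eq_cvg; apply: nearW => n.
by rewrite /= /f_ fE.
Unshelve. all: by end_near.
Qed.

(** Exponential Markov inequality: the indicator of [0 <= X] lies below [expR X]. *)
Lemma probability_ge0_le_expR {d} {T : measurableType d} {R : realType}
    (P : probability T R) (X : T -> R) : measurable_fun setT X ->
  (P [set w | (0 <= X w)%R] <= \int[P]_w (expR (X w))%:E)%E.
Proof.
move=> mX.
have mA : measurable [set w | 0 <= X w].
  by have := mX measurableT _ (measurable_itv `[0, +oo[); congr measurable;
    apply/seteqP; split => w /=; rewrite in_itv /= andbT // => -[].
have -> : P [set w | 0 <= X w] = (\int[P]_w (\1_[set w | (0 <= X w)%R] w)%:E)%E.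
  by rewrite integral_indic // setIT.
have mi : measurable_fun setT (fun w => (\1_[set w | 0 <= X w] w : R)%:E).
  by apply/measurable_EFinP; exact: measurable_indic.
have me : measurable_fun setT (fun w => (expR (X w))%:E).
  by apply/measurable_EFinP; exact: measurableT_comp.
apply: ge0_le_integral => //.
move=> w _; rewrite lee_fin indicE; case: (boolP (w \in _)); last first.
  by move=> _; exact: expR_ge0.
by rewrite inE /= => X0; rewrite -[leLHS]expR0 ler_expR.
Qed.

(** * Fading, noise and received powers *)

Lemma big_gaussian_parts {A : Type} {idx : A} (op : Monoid.com_law idx) (N : nat)
    (F : bool * bool * 'I_2 * 'I_N -> A) :
  \big[op/idx]_(k : bool * bool * 'I_2 * 'I_N) F k =
  \big[op/idx]_(isH : bool) \big[op/idx]_(isRe : bool)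
    \big[op/idx]_(l < 2) \big[op/idx]_(i < N) F (isH, isRe, l, i).
Proof.
rewrite !pair_bigA /=; apply: eq_bigr => -[[[a b] l] i] _ //.
Qed.

Section powers.
Context {R : realType} {N : nat}.
Local Notation part := (bool * bool * 'I_2 * 'I_N)%type.
Implicit Types (u : part -> R) (s : 'I_N -> R).

(** The powers are unnormalised, as the factor [(2 * N%:R)^-1] cancels in the estimator. This one is
    the limit of [received_power] divided by the symbol power. *)
Definition fading_power u : R :=
  \sum_(i < N) (u (true, true, ord0, i) ^+ 2 + u (true, false, ord0, i) ^+ 2).

Definition noise_power u : R :=
  \sum_(i < N) (u (false, true, ord_max, i) ^+ 2
                + u (false, false, ord_max, i) ^+ 2).

Definition received_power s u : R :=
  \sum_(i < N)
    ((s i * u (true, true, ord0, i) + u (false, true, ord0, i)) ^+ 2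
     + (s i * u (true, false, ord0, i) + u (false, false, ord0, i)) ^+ 2).

Definition coordinates (t : #|{: part}|.-tuple R) : part -> R :=
  fun k => tnth t (enum_rank k).

Lemma measurable_coordinates k :
  measurable_fun setT (fun t => coordinates t k).
Proof. exact: measurable_tnth. Qed.

Lemma measurable_fading_power :
  measurable_fun setT (fun t => fading_power (coordinates t)).
Proof.
apply: measurable_sum => i; apply: measurable_funD; apply: measurable_funX;
  exact: measurable_coordinates.
Qed.

Lemma measurable_noise_power :
  measurable_fun setT (fun t => noise_power (coordinates t)).
Proof.
apply: measurable_sum => i; apply: measurable_funD; apply: measurable_funX;
  exact: measurable_coordinates.
Qed.

Lemma measurable_received_power s :
  measurable_fun setT (fun t => received_power s (coordinates t)).
Proof.
by apply: measurable_sum => i; apply: measurable_funD; apply: measurable_funX;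
  apply: measurable_funD; try apply: measurable_funM => //;
  exact: measurable_coordinates.
Qed.

Lemma noise_power_ge0 u : 0 <= noise_power u.
Proof. by apply: sumr_ge0 => i _; rewrite addr_ge0 ?sqr_ge0. Qed.

Lemma fading_power_ge0 u : 0 <= fading_power u.
Proof. by apply: sumr_ge0 => i _; rewrite addr_ge0 ?sqr_ge0. Qed.

(** Weights that turn a combination of the fading and noise powers into one sum over all parts; the
    parts in neither power get 0. *)
Definition power_weight (a b : R) (k : part) : R :=
  let: (isH, _, l, _) := k in
  if isH then (if l == ord0 then a else 0) else (if l == ord0 then 0 else b).

Lemma sum_power_weight (a b : R) u :
  \sum_(k : part) power_weight a b k * u k ^+ 2
  = a * fading_power u + b * noise_power u.
Proof.
rewrite big_gaussian_parts !big_bool /= !big_ord_recl !big_ord0 /=.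
have -> : lift ord0 ord0 = ord_max :> 'I_2 by apply/val_inj.
rewrite -!mulr_sumr /fading_power /noise_power !big_split /= !mulrDr; ring.
Qed.

(** Each of [a] and [b] weighs [N] real and [N] imaginary parts, which gives the exponents; every
    part of weight 0 contributes a factor 1. *)
Lemma prod_power_weight (a b sH2 sV2 : R) :
  \prod_(k : part) (Num.sqrt (1 - 2 * power_weight a b k
                               * (if k.1.1.1 then sH2 else sV2)))^-1
  = (Num.sqrt (1 - 2 * a * sH2) ^- 2 * Num.sqrt (1 - 2 * b * sV2) ^- 2) ^+ N.
Proof.
rewrite big_gaussian_parts !big_bool /= !big_ord_recl !big_ord0 /=.
rewrite !mulr0 !mul0r !subr0 sqrtr1 invr1 !prodr_const !card_ord !expr1n.
by rewrite !mul1r !mulr1 -!exprMn -!expr2 !exprVn.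
Qed.

(** With [s ^+ 2 = r], the quotient [(s * h + v) ^+ 2 / r] expands to [h ^+ 2 + 2 * h * v * (s / r)
    + v ^+ 2 / r], whose last two terms tend to 0. *)
Lemma cvg_received_power (r_ : nat -> R) (s_ : nat -> 'I_N -> R) u :
  r_ n @[n --> \oo] --> +oo ->
  (forall n i, 0 < r_ n -> s_ n i ^+ 2 = r_ n) ->
  received_power (s_ n) u / r_ n @[n --> \oo] --> fading_power u.
Proof.
move=> rpinfty s2.
have r0 : \forall n \near \oo, 0 < r_ n by move/cvgryPgt : rpinfty; exact.
have rV0 : (r_ n)^-1 @[n --> \oo] --> (0 : R).
  exact/(gtr0_cvgV0 r0).
(* The sign of the symbol is free, so the bound goes through [(s / r) ^+ 2 = r^-1]. *)
have t0 i : s_ n i / r_ n @[n --> \oo] --> (0 : R).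
  apply/cvgr0Pnorm_lt => e e0.
  have e20 : 0 < e ^+ 2 by rewrite exprn_gt0.
  have /cvgr0Pnorm_lt /(_ _ e20) near_rV := rV0.
  near=> n.
  have rn0 : 0 < r_ n by near: n.
  have : `|(r_ n)^-1| < e ^+ 2 by near: n.
  rewrite gtr0_norm ?invr_gt0 // => rne.
  rewrite -(@ltr_pXn2r _ 2) ?nnegrE ?(ltW e0) // -normrX ger0_norm ?sqr_ge0 //.
  by rewrite exprMn s2 // expr2 mulrA mulfV ?gt_eqF // mul1r.
have term i h v : (s_ n i * h + v) ^+ 2 / r_ n @[n --> \oo] --> h ^+ 2.
  have : h ^+ 2 + 2 * h * v * (s_ n i / r_ n) + v ^+ 2 * (r_ n)^-1
      @[n --> \oo] --> h ^+ 2 + 2 * h * v * 0 + v ^+ 2 * 0.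
    apply: cvgD; [apply: cvgD; [exact: cvg_cst|]|].
    - by apply: cvgM; [exact: cvg_cst|exact: t0].
    - by apply: cvgM; [exact: cvg_cst|exact: rV0].
  rewrite !mulr0 !addr0; apply: cvg_trans; apply: near_eq_cvg; near=> n.
  have rn0 : 0 < r_ n by near: n.
  have := s2 n i rn0; set s := s_ n i; set r := r_ n in rn0 * => sr.
  have -> : h ^+ 2 = s ^+ 2 * h ^+ 2 / r.
    by rewrite sr mulrAC mulfV ?gt_eqF // mul1r.
  by rewrite /=; ring.
rewrite /received_power /fading_power.
under eq_cvg do rewrite mulr_suml.
pose F_ i n := ((s_ n i * u (true, true, ord0, i) + u (false, true, ord0, i)) ^+ 2
  + (s_ n i * u (true, false, ord0, i) + u (false, false, ord0, i)) ^+ 2) / r_ n.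
have addc : continuous (fun x : R * R => x.1 + x.2) by exact: add_continuous.
apply: (@cvg_big R _ +%R 0 xpredT addc _ _ _ F_) => i _.
rewrite /F_; under eq_cvg do rewrite mulrDl.
by apply: cvgD; exact: term.
Unshelve. all: by end_near.
Qed.

End powers.

(** * Ratio of fading power to noise power: measurability, tails and null events *)

(** The inverse is [expR (- ln x)] on the positive half-line, extended oddly to the negative one,
    and 0 at 0. *)
Lemma measurable_inv {R : realType} : measurable_fun setT (@GRing.inv R).
Proof.
have -> : @GRing.inv R = (fun x => \1_`]0, +oo[ x * expR (- ln x)
                          - \1_`]-oo, 0[ x * expR (- ln (- x))).
  apply/funext => x; rewrite !indicE !mem_setE !in_itv /= andbT.
  have [x0|x0|->] := ltrgt0P x; rewrite !(mul0r, mul1r, subr0, sub0r, invr0, oppr0) //.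
    by rewrite expRN lnK.
  by rewrite expRN lnK ?posrE ?oppr_gt0 // invrN opprK.
apply: measurable_funB; apply: measurable_funM.
- by apply: measurable_indic.
- by apply: measurableT_comp => //; apply: measurableT_comp => //; exact: measurable_ln.
- by apply: measurable_indic.
- apply: measurableT_comp => //; apply: measurableT_comp => //.
  by apply: measurableT_comp => //; exact: measurable_ln.
Qed.

Section gaussian_powers.
Context {d} {T : measurableType d} {R : realType} {N : nat}
  {P : probability T R}.
Local Notation part := (bool * bool * 'I_2 * 'I_N)%type.
Variables (Y : part -> {RV P >-> R}) (sH2 sV2 : R).
Hypothesis sH20 : 0 < sH2.
Hypothesis sV20 : 0 < sV2.
Hypothesis iY : mutually_independent Y.
Let v (k : part) := if k.1.1.1 then sH2 else sV2.
Hypothesis gY : forall k, centered_gaussian (v k) (Y k).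

Let A w := fading_power (Y^~ w).
Let B w := noise_power (Y^~ w).

Let v_gt0 k : 0 < v k.
Proof. by rewrite /v; case: ifP. Qed.

Let coordinates_tupled w : coordinates (tupled Y w) = Y^~ w.
Proof. by apply/funext => k; rewrite /coordinates tnth_tupled. Qed.

Lemma measurable_fading : measurable_fun setT A.
Proof.
rewrite (_ : A = (fun t => fading_power (coordinates t)) \o tupled Y).
  by apply: measurableT_comp => //; exact: measurable_fading_power.
by apply/funext => w /=; rewrite coordinates_tupled.
Qed.

Lemma measurable_noise : measurable_fun setT B.
Proof.
rewrite (_ : B = (fun t => noise_power (coordinates t)) \o tupled Y).
  by apply: measurableT_comp => //; exact: measurable_noise_power.
by apply/funext => w /=; rewrite coordinates_tupled.
Qed.

(* Chernoff's bound at the optimal parameter [t = (q - 1) / (4 * q)]. *)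
Lemma power_ratio_tail (q : R) : 0 < q ->
  (P [set w | (0 <= (q - 1) * (A w / sH2 - q * (B w / sV2)))%R]
   <= ((4 * q / (q + 1) ^+ 2) ^+ N)%:E)%E.
Proof.
move=> q0.
(* The factor [q - 1] in the event, whose sign [t] shares, lets one bound serve the upper tail for
   [q > 1] and the lower tail for [q < 1]. *)
pose t := (q - 1) / (4 * q).
have q4 : 0 < 4 * q by rewrite mulr_gt0.
have sH2n : sH2 != 0 by rewrite gt_eqF.
have sV2n : sV2 != 0 by rewrite gt_eqF.
have qn : q != 0 by rewrite gt_eqF.
pose c := @power_weight R N (t / sH2) (- (t * q / sV2)).
pose X w := \sum_(k : part) c k * Y k w ^+ 2.
have XE w : X w = (q - 1) * (A w / sH2 - q * (B w / sV2)) / (4 * q).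
  rewrite /X (sum_power_weight _ _ (Y^~ w)) -/(A w) -/(B w) /t.
  by field; rewrite qn sH2n sV2n.
have mX : measurable_fun setT X.
  by apply: measurable_sum => k; apply: measurable_funM => //; exact: measurable_funX.
have -> : [set w | 0 <= (q - 1) * (A w / sH2 - q * (B w / sV2))] = [set w | 0 <= X w].
  apply/seteqP; split => w /=; rewrite XE (@pmulr_lge0 _ (4 * q)^-1) ?invr_gt0 //.
apply: le_trans (probability_ge0_le_expR P X mX) _.
(* The two moment factors are positive, and the inverse of their product is
   [4 * q / (q + 1) ^+ 2]. *)
have dH : 1 - 2 * (t / sH2) * sH2 = (q + 1) / (2 * q).
  by rewrite /t; field; rewrite qn sH2n.
have dV : 1 - 2 * - (t * q / sV2) * sV2 = (q + 1) / 2.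
  by rewrite /t; field; rewrite qn sV2n.
have dH0 : 0 < (q + 1) / (2 * q) by rewrite divr_gt0 ?mulr_gt0 ?addr_gt0.
have dV0 : 0 < (q + 1) / 2 by rewrite divr_gt0 ?addr_gt0.
rewrite /X (integral_expR_sum_sqr Y v iY v_gt0 gY c) ?index_enum_uniq //; last first.
  move=> [[[isH isRe] l] i]; rewrite -subr_gt0 /c /power_weight /v /=.
  case: isH; case: ifP => _; rewrite ?dH ?dV //; by rewrite mulr0 mul0r subr0.
rewrite /c prod_power_weight dH dV !sqr_sqrtr ?(ltW dH0) ?(ltW dV0) //.
rewrite lee_fin le_eqVlt; apply/orP; left; apply/eqP; congr (_ ^+ _).
by field; rewrite qn gt_eqF // addr_gt0.
Qed.

(** A positive [N] provides a first index; the equation determines the square of the real fading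
    part there from the other parts. *)
Lemma power_ratio_null (q : R) : (0 < N)%N -> P [set w | A w = q * B w] = 0%E.
Proof.
move=> N0; pose i0 := Ordinal N0; pose j : part := (true, true, ord0, i0).
pose g (t : #|{: part}|.-tuple R) :=
  q * noise_power (coordinates t) - fading_power (coordinates t).
have mg : measurable_fun setT g.
  apply: measurable_funB; last exact: measurable_fading_power.
  by apply: measurable_funM => //; exact: measurable_noise_power.
rewrite -(gaussian_sqr_null Y v iY gY j 1 g (oner_neq0 R) mg).
congr (P _); apply/seteqP.
have nB w : noise_power (coordinates (tupled (zeroed Y j) w)) = B w.
  by apply: eq_bigr => i _; rewrite /coordinates !tnth_tupled /zeroed /=.
have nA w : A w = Y j w ^+ 2 + fading_power (coordinates (tupled (zeroed Y j) w)).
  rewrite /A /fading_power (bigD1 i0) //= [in RHS](bigD1 i0) //=.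
  rewrite /coordinates !tnth_tupled /zeroed eqxx /=.
  rewrite expr0n /= add0r addrA; congr (_ + _).
  apply: eq_bigr => i ii0; rewrite !tnth_tupled.
  by rewrite !xpair_eqE /= (negbTE ii0).
split => w /=; rewrite /g nB nA mul1r.
  by move=> <-; rewrite addrK.
by move=> ->; rewrite subrK.
Qed.

(** Outside the tail events at [1 + e] and [1 - e] the relative error is below [e], and each tail
    has probability less than [delta / 4]. *)
Lemma fading_ratio_probability (e delta : R) : 0 < e < 1 -> 0 < delta < 1 ->
  2 * (2 + e) * (6 + 5 * e) * ln (4 / delta) / (3 * e ^+ 2) < N%:R ->
  1 - delta < fine (P [set w |
    (`| (A w / B w - sH2 / sV2) / (sH2 / sV2) | < e)%R]).
Proof.
move=> /andP[e0 e1] /andP[d0 d1] HN.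
pose a := e / (2 + e).
have L0 : 0 < ln (4 / delta) by rewrite ln_gt0 // ltr_pdivlMr //; lra.
have e2 : 0 < 2 + e by lra.
(* The assumed bound on [N] suffices because [3 * (2 + e) <= 2 * (6 + 5 * e)]. *)
have Na : ln (4 / delta) < N%:R * a ^+ 2.
  have e20 : 0 < e ^+ 2 by rewrite exprn_gt0.
  move: HN; rewrite ltr_pdivrMr ?mulr_gt0 // => HN.
  rewrite /a exprMn exprVn mulrA ltr_pdivlMr ?exprn_gt0 //.
  have : ln (4 / delta) * (2 * (2 + e) * (6 + 5 * e)) < 3 * (N%:R * e ^+ 2) by nra.
  have : 3 * (ln (4 / delta) * (2 + e) ^+ 2) <= ln (4 / delta) * (2 * (2 + e) * (6 + 5 * e)).
    rewrite mulrCA ler_pM2l //; nra.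
  lra.
have bound q : 0 < q -> a ^+ 2 <= ((q - 1) / (q + 1)) ^+ 2 ->
    (4 * q / (q + 1) ^+ 2) ^+ N < delta / 4.
  move=> q0 aq.
  have q1 : q + 1 != 0 by rewrite gt_eqF // addr_gt0.
  have qE : 4 * q / (q + 1) ^+ 2 = 1 - ((q - 1) / (q + 1)) ^+ 2 by field.
  have qa : 4 * q / (q + 1) ^+ 2 <= expR (- a ^+ 2).
    rewrite qE; apply: le_trans (expR_ge1Dx _); lra.
  apply: le_lt_trans (_ : expR (- a ^+ 2) ^+ N < _).
    by rewrite lerXn2r // ?nnegrE ?expR_ge0 // divr_ge0 ?sqr_ge0 // mulr_ge0 // ltW.
  rewrite -expRM_natl -(@lnK _ (delta / 4)) ?posrE ?divr_gt0 //.
  rewrite ltr_expR -ltrN2 -lnV ?posrE ?divr_gt0 // invf_div mulrN opprK.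
  exact: Na.
have r0 : 0 < sH2 / sV2 by rewrite divr_gt0.
pose U q := [set w | 0 <= (q - 1) * (A w / sH2 - q * (B w / sV2))].
have mU q : measurable (U q).
  have mf : measurable_fun setT (fun w => (q - 1) * (A w / sH2 - q * (B w / sV2))).
    apply: measurable_funM => //; apply: measurable_funB.
      by apply: measurable_funM => //; exact: measurable_fading.
    apply: measurable_funM => //; apply: measurable_funM => //.
    exact: measurable_noise.
  by have := mf measurableT _ (measurable_itv `[0, +oo[); congr measurable;
    apply/seteqP; split => w /=; rewrite in_itv /= andbT // => -[].
set E := [set w | _ < e].
have EU : ~` (U (1 + e) `|` U (1 - e)) `<=` E.
  move=> w /not_orP[/negP + /negP]; rewrite -!ltNge /E /=.
  rewrite (_ : 1 + e - 1 = e); last by ring.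
  rewrite (_ : 1 - e - 1 = - e); last by ring.
  rewrite pmulr_rlt0 // nmulr_rlt0 ?oppr_lt0 // subr_lt0 subr_gt0.
  have B0 := noise_power_ge0 (Y^~ w); rewrite -/(B w) in B0.
  have A0 := fading_power_ge0 (Y^~ w); rewrite -/(A w) in A0.
  (* If [B w] vanished, the strict upper bound would make [A w / sH2] negative. *)
  have [->|Bn0] := eqVneq (B w) 0.
    by rewrite mul0r !mulr0 ltNge divr_ge0 // ltW.
  have Bgt0 : 0 < B w by rewrite lt_def Bn0.
  have -> : (A w / B w - sH2 / sV2) / (sH2 / sV2) = A w / sH2 / (B w / sV2) - 1.
    by field; rewrite !gt_eqF.
  have b0 : 0 < B w / sV2 by rewrite divr_gt0.
  rewrite -(ltr_pdivrMr _ _ b0) -(ltr_pdivlMr _ _ b0) ltr_norml.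
  by move=> h1 h2; apply/andP; split; lra.
have mE : measurable E.
  rewrite -[X in measurable X]setTI.
  have mf : measurable_fun setT (fun w => `|(A w / B w - sH2 / sV2) / (sH2 / sV2)|).
    apply: measurableT_comp => //; apply: measurable_funM => //.
    apply: measurable_funB => //; apply: measurable_funM; first exact: measurable_fading.
    apply: measurableT_comp; last exact: measurable_noise.
    exact: measurable_inv.
  by have := mf measurableT _ (measurable_itv `]-oo, e[); congr measurable;
    apply/seteqP; split => w /=; rewrite in_itv.
pose V := U (1 + e) `|` U (1 - e).
have mV : measurable V by exact: measurableU.
have PV : (P V < delta%:E)%E.
  apply: le_lt_trans (measureU2 _ (mU _) (mU _)) _.
  apply: le_lt_trans (leeD (power_ratio_tail (1 + e)%R _) (power_ratio_tail (1 - e)%R _)) _.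
  - lra.
  - lra.
  rewrite -EFinD lte_fin.
  have h1 : (4 * (1 + e) / (1 + e + 1) ^+ 2) ^+ N < delta / 4.
    apply: bound; first lra.
    rewrite /a (_ : 1 + e - 1 = e); last by ring.
    by rewrite (_ : 1 + e + 1 = 2 + e); last by ring.
  have h2 : (4 * (1 - e) / (1 - e + 1) ^+ 2) ^+ N < delta / 4.
    apply: bound; first lra.
    rewrite /a (_ : 1 - e - 1 = - e); last by ring.
    rewrite (_ : 1 - e + 1 = 2 - e); last by ring.
    (* At [q = 1 - e] the quotient is, up to sign, [e / (2 - e)], which is at least [a]. *)
    rewrite mulNr sqrrN lerXn2r // ?nnegrE ?divr_ge0 //; try lra.
    by rewrite ler_pM2l // lef_pV2 ?posrE; lra.
  lra.
have PVE : (1 - P V <= P E)%E.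
  rewrite -probability_setC //; apply: le_measure EU; rewrite ?inE //.
  exact: measurableC.
move: PV PVE; rewrite -(@fineK _ (P V)) ?fin_num_measure //.
rewrite -(@fineK _ (P E)) ?fin_num_measure // -EFinB lee_fin lte_fin; lra.
Qed.

End gaussian_powers.

(** * The estimator in terms of the powers *)

Section estimate.
Context {R : realType} {N : nat}.
Local Notation part := (bool * bool * 'I_2 * 'I_N)%type.

(** The estimator at zero second power, with [p] dividing each power separately so that each term of
    the numerator has its own limit. *)
Definition estimate (s : 'I_N -> R) (p : R) (u : part -> R) : R :=
  (received_power s u / p - noise_power u / p) / noise_power u.

Lemma measurable_estimate (s : 'I_N -> R) (p : R) :
  measurable_fun setT (fun t => estimate s p (coordinates t)).
Proof.
apply: measurable_funM; last first.
  by apply: measurableT_comp; [exact: measurable_inv|exact: measurable_noise_power].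
apply: measurable_funB; apply: measurable_funM => //.
  exact: measurable_received_power.
exact: measurable_noise_power.
Qed.

Variables (M : two_power_data R N) (sH2 sV2 Ps1 : R).
Hypothesis hM : two_power_rayleigh M sH2 sV2 Ps1 0.

Let Y : part -> {RV Pr M >-> R} := @gaussian_part R N M.

Lemma centered_gaussian_part (k : part) :
  centered_gaussian (if k.1.1.1 then sH2 else sV2) (Y k).
Proof.
case: hM => _ _ hH hV _.
by case: k => [[[[] []] l] i]; [case: (hH l i)|case: (hH l i)|case: (hV l i)|case: (hV l i)].
Qed.

Lemma mean_power_received w : mean_power ord0 w
  = (2 * N%:R)^-1 * received_power (symbol M ord0) (Y^~ w).
Proof.
rewrite /mean_power; congr (_ * _); apply: eq_bigr => i _.
rewrite /observation /fading /noise /= sqr_sqrtr ?addr_ge0 ?sqr_ge0 //.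
by rewrite mulr0 subr0 mulr0 add0r ![symbol _ _ _ * _]mulrC.
Qed.

(** Zero power forces the symbols to vanish, so these observations are pure noise. *)
Lemma mean_power_noise w : mean_power ord_max w
  = (2 * N%:R)^-1 * noise_power (Y^~ w).
Proof.
case: hM => _ hs _ _ _.
rewrite /mean_power; congr (_ * _); apply: eq_bigr => i _.
have s0 : symbol M ord_max i = 0.
  by have [_ /eqP] := hs i; rewrite sqrf_eq0 normr_eq0 => /eqP.
rewrite /observation /fading /noise /= sqr_sqrtr ?addr_ge0 ?sqr_ge0 //.
by rewrite s0 !mulr0 subr0 addr0 !add0r.
Qed.

(** The common normalisation is nonzero and cancels; where the noise power is 0, both sides take the
    value 0. *)
Lemma ratio_estimatorE w : (0 < N)%N ->
  ratio_estimator Ps1 0 w = estimate (symbol M ord0) Ps1 (Y^~ w).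
Proof.
move=> N0; rewrite /ratio_estimator mean_power_received mean_power_noise.
have k0 : (2 * N%:R)^-1 != 0 :> R.
  by rewrite invr_eq0 mulf_neq0 // pnatr_eq0 -?lt0n.
move: k0; set k := (2 * N%:R)^-1 => k0.
rewrite mul0r subr0 -mulrBr mulrCA invfM mulrACA mulfV // mul1r invfM.
by rewrite mulrA mulrBl.
Qed.

End estimate.

(** * Limit at large power and final bound *)

Theorem corollary4 (R : realType) (sH2 sV2 eps delta : R) (N : nat)
    (M : R -> two_power_data R N) :
  0 < sH2 -> 0 < sV2 -> 0 < eps < 1 -> 0 < delta < 1 -> (0 < N)%N ->
  (forall Ps1 : R, 0 < Ps1 -> two_power_rayleigh (M Ps1) sH2 sV2 Ps1 0) ->
  2 * (2 + eps) * (6 + 5 * eps) * ln (4 / delta) / (3 * eps ^+ 2) < N%:R ->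
  exists l : R,
    (fine (Pr (M Ps1) [set w |
        `| (ratio_estimator Ps1 0 w - sH2 / sV2) / (sH2 / sV2) | < eps])
      @[Ps1 --> +oo] --> l)
    /\ 1 - delta < l.
Proof.
move=> sH20 sV20 eps01 delta01 N0 hM hN.
pose Y p := @gaussian_part R N (M p).
have gY p (p0 : 0 < p) := @centered_gaussian_part R N (M p) sH2 sV2 p (hM p p0).
have iY p (p0 : 0 < p) : mutually_independent (Y p) by case: (hM p p0).
have lt01 : 0 < 1 :> R by [].
pose A w := fading_power (fun k => Y 1 k w).
pose B w := noise_power (fun k => Y 1 k w).
pose r := sH2 / sV2.
have r0 : r != 0 by rewrite gt_eqF // divr_gt0.
exists (fine (Pr (M 1) [set w | `|(A w / B w - r) / r| < eps])); split; last first.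
  exact: (fading_ratio_probability (Y 1) sH2 sV2 sH20 sV20 (iY 1 lt01) (gY 1 lt01)).
(* Dominated convergence is sequential, so the limit is tested along sequences tending to
   infinity. *)
apply/cvg_pinftyP => p_ p_oo.
pose s_ n := symbol (M (p_ n)) ord0.
(* The symbols come from the model at power [p_ n], the gaussian parts from the model at power 1. *)
pose X_ n w := (estimate (s_ n) (p_ n) (fun k => Y 1 k w) - r) / r.
have mA : measurable_fun setT A by exact: measurable_fading.
have mB : measurable_fun setT B by exact: measurable_noise.
have mX : measurable_fun setT (fun w => (A w / B w - r) / r).
  apply: measurable_funM => //; apply: measurable_funB => //.
  by apply: measurable_funM => //; apply: measurableT_comp => //; exact: measurable_inv.
have cvgX : fine (Pr (M 1) [set w | `|X_ n w| < eps]) @[n --> \oo] -->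
    fine (Pr (M 1) [set w | `|(A w / B w - r) / r| < eps]).
  apply: cvg_probability_norm_lt.
  - move=> n; apply: measurable_funM => //; apply: measurable_funB => //.
    rewrite (_ : (fun w => _) =
        (fun t => estimate (s_ n) (p_ n) (coordinates t)) \o tupled (Y 1)).
      by apply: measurableT_comp => //; exact: measurable_estimate.
    apply/funext => w /=; congr estimate; apply/funext => k.
    by rewrite /coordinates tnth_tupled.
  - exact: mX.
  - move=> w; apply: cvgM; last exact: cvg_cst.
    apply: cvgB; last exact: cvg_cst.
    apply: cvgM; last exact: cvg_cst.
    rewrite -[X in _ --> X]subr0; apply: cvgB.
      apply: cvg_received_power => // n i p0.
      by have [_ /(_ i)[+ _] _ _ _] := hM _ p0; rewrite real_normK ?num_real.
    rewrite -(mulr0 (B w)); apply: cvgM; first exact: cvg_cst.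
    have p0 : \forall n \near \oo, 0 < p_ n by move/cvgryPgt : p_oo; exact.
    exact/(gtr0_cvgV0 p0).
  have null q : Pr (M 1) [set w | A w = q * B w] = 0%E.
    exact: (power_ratio_null (Y 1) sH2 sV2 (iY 1 lt01) (gY 1 lt01)).
  have meq q : measurable [set w | A w = q * B w].
    have mf : measurable_fun setT (fun w => A w - q * B w).
      by apply: measurable_funB => //; exact: measurable_funM.
    have := mf measurableT _ (measurable_set1 0); rewrite setTI; congr measurable.
    apply/seteqP; split => w /=; last by move=> ->; rewrite subrr.
    by move/eqP; rewrite subr_eq0 => /eqP.
  (* Solving [(A / B - r) / r = eps] or [- eps] for [A] gives the two null events. *)
  apply: (subset_measure0 (B := [set w | A w = r * (1 + eps) * B w]
    `|` [set w | A w = r * (1 - eps) * B w])) => //.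
  - have mf : measurable_fun setT (fun w => `|(A w / B w - r) / r|).
      exact: measurableT_comp.
    by have := mf measurableT _ (measurable_set1 eps); rewrite setTI.
  - exact: measurableU.
  - move=> w /= Xe.
    (* Where [B w] is 0 the quotient is 0 by default and the error is -1, which [eps < 1]
       excludes. *)
    have [B0|B0] := eqVneq (B w) 0.
      move: Xe eps01; rewrite B0 invr0 mulr0 sub0r mulNr divff // normrN1 => <-.
      by rewrite ltxx andbF.
    have AE : A w = r * (1 + (A w / B w - r) / r) * B w by field; rewrite B0 r0.
    have : (A w / B w - r) / r = eps \/ (A w / B w - r) / r = - eps.
      have [x0|x0] := leP 0 ((A w / B w - r) / r).
        by left; rewrite -Xe ger0_norm.
      by right; rewrite -Xe ltr0_norm // opprK.
    by case=> xE; rewrite xE in AE; [left|right].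
  - apply/eqP; rewrite -measure_le0.
    apply: le_trans (measureU2 _ (meq _) (meq _)) _.
    have nle (q : R) : (Pr (M 1%R) [set w | (A w = q * B w)%R] <= 0)%E by rewrite null.
    by rewrite -[leRHS]adde0; exact: (leeD (nle _) (nle _)).
(* Both sequences of probabilities agree as soon as [p_ n] is positive. *)
apply: cvg_trans cvgX; apply: near_eq_cvg.
have p0 : \forall n \near \oo, 0 < p_ n by move/cvgryPgt : p_oo; exact.
near=> n; have pn0 : 0 < p_ n by near: n.
congr fine.
pose E := [set t : #|{: bool * bool * 'I_2 * 'I_N}|.-tuple R |
  `|(estimate (s_ n) (p_ n) (coordinates t) - r) / r| < eps].
have mE : measurable E.
  rewrite -[X in measurable X]setTI.
  have mf : measurable_fun setT (fun t : #|{: bool * bool * 'I_2 * 'I_N}|.-tuple R =>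
     `|(estimate (s_ n) (p_ n) (coordinates t) - r) / r|).
    apply: measurableT_comp => //; apply: measurable_funM => //.
    by apply: measurable_funB => //; exact: measurable_estimate.
  by have := mf measurableT _ (measurable_itv `]-oo, eps[); congr measurable;
    apply/seteqP; split => t /=; rewrite in_itv.
have cE p w : coordinates (tupled (Y p) w) = (fun k => Y p k w).
  by apply/funext => k; rewrite /coordinates tnth_tupled.
transitivity (Pr (M 1) (tupled (Y 1) @^-1` E)).
  by congr (Pr _ _); apply/seteqP; split => w /=; rewrite /E /= cE.
(* Change of probability space: [E] depends only on the tuple of gaussian parts, whose law is the
   same at every positive power. *)
transitivity (Pr (M (p_ n)) (tupled (Y (p_ n)) @^-1` E)).
  apply: independent_law_unique => //; [exact: iY|exact: iY|].
  move=> k C mC; have := gY 1 lt01 k C mC; rewrite /distribution /pushforward => ->.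
  by have := gY _ pn0 k C mC; rewrite /distribution /pushforward => ->.
congr (Pr _ _); apply/seteqP; split => w /=; rewrite /E /= cE;
  by rewrite (ratio_estimatorE (M (p_ n)) sH2 sV2 (p_ n) (hM _ pn0)).
Unshelve. all: by end_near.
Qed.
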